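(* Let $d_2\ge2$ be an even integer and let $a_{1,0},a_{2,0},b_0$ be nonzero complex numbers. Consider the system $$\dot x_1=-2x_1v_1,\quad \dot x_2=-2x_2(2v_1+v_2),\quad \dot x_3=x_3v_3,$$ $$\dot v_1=-v_1v_3+\tfrac1{d_2}(x_1+2x_2),\quad \dot v_2=-v_2v_3+x_2,\quad \dot v_3=-d_2v_1^2-v_2^2,$$ and the series expansions $$x_1=\sum_{i\ge0}a_{1,i}t^{i},\quad x_2=\sum_{i\ge0}a_{2,i}t^{2+i},\quad x_3=\sum_{i\ge0}b_it^{1+i},$$ $$v_1=\sum_{i\ge0}c_{1,i}t^{1+i},\quad v_2=\sum_{i\ge0}c_{2,i}t^{-1+i},\quad v_3=\sum_{i\ge0}e_it^{-1+i},$$ with $c_{1,0}=a_{1,0}/(2d_2)$, $c_{2,0}=-1$, $e_0=1$. Then these series expansions satisfy the compatibility conditions at the top resonance $i=2$. Moreover, the free parameter at the resonance can be chosen so that the series lie on the hypersurface $H=0$.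
   Context: Substituting the expansions gives, for each $i\ge1$, a linear system $X(i)(a_{1,i},a_{2,i},b_i,c_{1,i},c_{2,i},e_i)^T=R_i$, where $$X(i)=\begin{pmatrix}i&0&0&0&0&0\\0&i&0&0&2a_{2,0}&0\\0&0&i&0&0&-b_0\\-1/d_2&0&0&i+2&0&c_{1,0}\\0&0&0&0&i&-1\\0&0&0&0&-2&i-1\end{pmatrix},$$ $$R_i=\begin{pmatrix}-2\sum_{k=0}^{i-2}a_{1,i-2-k}c_{1,k}\\-4\sum_{k=0}^{i-2}a_{2,i-2-k}c_{1,k}-2\sum_{k=1}^{i-1}a_{2,i-k}c_{2,k}\\ \sum_{k=1}^{i-1}b_{i-k}e_k\\-\sum_{k=1}^{i-1}c_{1,i-k}e_k+2d_2^{-1}a_{2,i-2}\\-\sum_{k=1}^{i-1}c_{2,i-k}e_k+a_{2,i-4}\\-d_2\sum_{k=0}^{i-4}c_{1,i-4-k}c_{1,k}-\sum_{k=1}^{i-1}c_{2,i-k}c_{2,k}\end{pmatrix},$$ with coefficients of negative index equal to zero. Resonances are the values of $i$ with $\det X(i)=0$; the largest is $i=2$. The compatibility conditions at $i=2$ hold if $R_2$, computed from the previous steps, lies in the image of $X(2)$. The free parameter at the resonance is the parameter of the (one-dimensional affine) solution space of the linear system at $i=2$. Here $H=-x_3(d_2v_1^2+v_2^2-v_3^2+x_1+x_2+1)$, and lying on $H=0$ means that the factor in parentheses vanishes identically as a formal series. *)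

(* Defs.v *)
From HB Require Import structures.
From mathcomp Require Import all_boot all_order all_algebra.
From mathcomp Require Import reals.
From mathcomp Require Import complex.

Set Implicit Arguments.
Unset Strict Implicit.
Unset Printing Implicit Defensive.

Import Order.TTheory GRing.Theory Num.Theory.
Local Open Scope ring_scope.

(* [Laurent m c] stands for the formal series \sum_(k >= 0) c k t^(m + k).  The
   coefficient [c 0] may vanish, so [m] is only a lower bound for the order and
   series must be compared with [leqv], not with Leibniz equality. *)
Record laurent (C : Type) := Laurent { lorder : int; lcoef : nat -> C }.

Declare Scope laurent_scope.
Delimit Scope laurent_scope with L.
Bind Scope laurent_scope with laurent.

Section LaurentSeries.
Variable C : fieldType.
Implicit Types (f g : laurent C) (a : C).

Definition coefL f (n : int) : C :=
  if lorder f <= n then lcoef f `|n - lorder f|%N else 0.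

Definition leqv f g : Prop := forall n : int, coefL f n = coefL g n.

Definition constL a : laurent C := Laurent 0 (fun k => if k == 0%N then a else 0).

Definition addL f g : laurent C :=
  let m := Num.min (lorder f) (lorder g) in
  Laurent m (fun k => coefL f (m + k%:Z) + coefL g (m + k%:Z)).

Definition scaleL a f : laurent C :=
  Laurent (lorder f) (fun k => a * lcoef f k).

Definition mulL f g : laurent C :=
  Laurent (lorder f + lorder g)
    (fun k => \sum_(j < k.+1) lcoef f j * lcoef g (k - j)%N).

Definition derivL f : laurent C :=
  Laurent (lorder f - 1) (fun k => (lorder f + k%:Z)%:~R * lcoef f k).

End LaurentSeries.

Notation "f + g" := (addL f g) : laurent_scope.
Notation "f * g" := (mulL f g) : laurent_scope.
Notation "a *: f" := (scaleL a%R f) : laurent_scope.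
Notation "- f" := (scaleL (- 1)%R f) : laurent_scope.
Notation "f - g" := (addL f (scaleL (- 1)%R g)) : laurent_scope.
Notation "f == g" := (leqv f g) : laurent_scope.

Record coeffs (C : Type) := Coeffs {
  a1_ : nat -> C; a2_ : nat -> C; b_ : nat -> C;
  c1_ : nat -> C; c2_ : nat -> C; e_ : nat -> C }.

Section System.
Variables (C : fieldType) (d2 : nat).
Implicit Types (s : coeffs C) (i : nat).

Definition initial (a10 a20 b0 : C) s : Prop :=
  [/\ a1_ s 0 = a10, a2_ s 0 = a20 & b_ s 0 = b0] /\
  [/\ c1_ s 0 = a10 / (2 * d2%:R), c2_ s 0 = -1 & e_ s 0 = 1].

Definition x1 s := Laurent 0 (a1_ s).
Definition x2 s := Laurent 2 (a2_ s).
Definition x3 s := Laurent 1 (b_ s).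
Definition v1 s := Laurent 1 (c1_ s).
Definition v2 s := Laurent (- 1) (c2_ s).
Definition v3 s := Laurent (- 1) (e_ s).

Definition formal_solution s : Prop :=
  [/\ (derivL (x1 s) == (- 2) *: (x1 s * v1 s))%L,
      (derivL (x2 s) == (- 2) *: (x2 s * (2 *: v1 s + v2 s)))%L &
      (derivL (x3 s) == x3 s * v3 s)%L] /\
  [/\ (derivL (v1 s) == - (v1 s * v3 s) + d2%:R^-1 *: (x1 s + 2 *: x2 s))%L,
      (derivL (v2 s) == - (v2 s * v3 s) + x2 s)%L &
      (derivL (v3 s) == - (d2%:R *: (v1 s * v1 s)) - v2 s * v2 s)%L].

(* H = - x_3 (d_2 v_1^2 + v_2^2 - v_3^2 + x_1 + x_2 + 1); lying on H = 0 means
   that the second factor vanishes. *)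
Definition on_H0 s : Prop :=
  (d2%:R *: (v1 s * v1 s) + v2 s * v2 s - v3 s * v3 s + x1 s + x2 s + constL 1
     == constL 0)%L.

Definition vec s i : 'cV[C]_6 :=
  \col_(r < 6) nth 0 [:: a1_ s i; a2_ s i; b_ s i; c1_ s i; c2_ s i; e_ s i] r.

(* X depends on s only through a_{2,0}, b_0 and c_{1,0}. *)
Definition X s (i : int) : 'M[C]_6 :=
  let z : C := i%:~R in
  \matrix_(r < 6, c < 6) nth 0 (nth [::]
    [:: [:: z; 0; 0; 0; 0; 0];
        [:: 0; z; 0; 0; 2 * a2_ s 0; 0];
        [:: 0; 0; z; 0; 0; - b_ s 0];
        [:: - d2%:R^-1; 0; 0; z + 2; 0; c1_ s 0];
        [:: 0; 0; 0; 0; z; -1];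
        [:: 0; 0; 0; 0; -2; z - 1]] r) c.

(* The coefficient a_{i-j}, equal to 0 when i - j is negative. *)
Definition before (a : nat -> C) i (j : nat) : C :=
  if (j <= i)%N then a (i - j)%N else 0.

(* The bounds k < i - 1 and k < i - 3 encode k <= i - 2 and k <= i - 4: with
   truncated subtraction the sums are empty when i < 2, resp. i < 4. *)
Definition rhs s i : 'cV[C]_6 :=
  \col_(r < 6) nth 0
    [:: - 2 * \sum_(0 <= k < i - 1) a1_ s (i - 2 - k) * c1_ s k;
        - 4 * (\sum_(0 <= k < i - 1) a2_ s (i - 2 - k) * c1_ s k)
          - 2 * (\sum_(1 <= k < i) a2_ s (i - k) * c2_ s k);
        \sum_(1 <= k < i) b_ s (i - k) * e_ s k;
        - (\sum_(1 <= k < i) c1_ s (i - k) * e_ s k)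
          + 2 * d2%:R^-1 * before (a2_ s) i 2;
        - (\sum_(1 <= k < i) c2_ s (i - k) * e_ s k) + before (a2_ s) i 4;
        - d2%:R * (\sum_(0 <= k < i - 3) c1_ s (i - 4 - k) * c1_ s k)
          - \sum_(1 <= k < i) c2_ s (i - k) * c2_ s k] r.

Definition step s i : Prop := X s i%:Z *m vec s i = rhs s i.

Definition resonance s (i : int) : Prop := \det (X s i) = 0.

Definition top_resonance s (i : int) : Prop :=
  resonance s i /\ forall j : int, resonance s j -> j <= i.

Definition compatible s i : Prop :=
  exists u : 'cV[C]_6, X s i%:Z *m u = rhs s i.

End System.

(* Main.v *)
Require Import Defs.
From HB Require Import structures.
From mathcomp Require Import all_boot all_order all_algebra.
From mathcomp Require Import reals.
From mathcomp Require Import complex.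
From mathcomp Require Import ring zify.
Import Order.TTheory GRing.Theory Num.Theory.
Local Open Scope ring_scope.

Set Implicit Arguments.
Unset Strict Implicit.
Unset Printing Implicit Defensive.

(* A formal solution with the given leading terms is the same thing as a sequence
   solving X(i) u = R_i for all i >= 1.  Since det X(i) vanishes only at
   i = -2, -1, 0, 2, the step i = 1 gives 0, the step i = 2 is a compatible
   system with solution line p + z w, and each choice of z extends uniquely
   through the steps i >= 3.  The factor
   d_2 v_1^2 + v_2^2 - v_3^2 + x_1 + x_2 + 1 of H has zero derivative along the
   system, so it reduces to its constant term, which is a_{1,0} + 1 - 6 z; the
   series therefore lie on H = 0 for z = (a_{1,0} + 1) / 6. *)

(** * Coefficients of formal Laurent series and Cauchy products *)

Section CoefL.
Variable C : fieldType.
Implicit Types (f g : laurent C) (a b : nat -> C).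

Definition conv a b (k : nat) : C := \sum_(j < k.+1) a j * b (k - j)%N.

Lemma coefL_lt f n : n < lorder f -> coefL f n = 0.
Proof. by move=> h; rewrite /coefL leNgt h. Qed.

(** The terms of an equation start at different orders. Reading all of them from a common exponent
    [m] turns each excess order into a shift by [before]. *)
Lemma coefL_before f (m : int) (j i : nat) : lorder f = m + j%:Z ->
  coefL f (m + i%:Z) = before (lcoef f) i j.
Proof.
move=> h; rewrite /coefL /before h.
have -> : (m + j%:Z <= m + i%:Z) = (j <= i)%N by lia.
by case: leqP => // ji; congr lcoef; lia.
Qed.

Lemma coefL_add f g n : coefL (addL f g) n = coefL f n + coefL g n.
Proof.
rewrite {1}/coefL /=; set m := Num.min _ _.
have [mn|nm] := lerP m n.
  by have -> : m + `|n - m|%N%:Z = n by lia.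
by rewrite !coefL_lt ?addr0 //; move: nm; rewrite /m; lia.
Qed.

Lemma coefL_scale c f n : coefL (scaleL c f) n = c * coefL f n.
Proof. by rewrite /coefL /=; case: ifP; rewrite ?mulr0. Qed.

Lemma coefL_deriv f n : coefL (derivL f) n = (n + 1)%:~R * coefL f (n + 1).
Proof.
rewrite /coefL /=.
have -> : (lorder f - 1 <= n) = (lorder f <= n + 1) by lia.
case: ifP => h; last by rewrite mulr0.
by congr (_%:~R * lcoef f _); lia.
Qed.

(** Passes from integer exponents to a natural index [i], so that equality of series becomes a
    recurrence. *)
Lemma leqv_shift f g m :
  (forall n, n < m -> coefL f n = 0) -> (forall n, n < m -> coefL g n = 0) ->
  leqv f g <-> forall i : nat, coefL f (m + i%:Z) = coefL g (m + i%:Z).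
Proof.
move=> hf hg; split=> [h i|h n]; first exact: h.
have [nm|mn] := ltP n m; first by rewrite hf ?hg.
by have -> : n = m + `|n - m|%N%:Z by lia.
Qed.

(** Multiplication by [t^j] commutes with the Cauchy product: the terms with [i - j < k] vanish. *)
Lemma conv_before a b i j : conv a (fun k => before b k j) i = before (conv a b) i j.
Proof.
rewrite /before /conv; case: leqP => ji.
  rewrite -(big_mkord xpredT (fun k => a k * (if (j <= i - k)%N then b (i - k - j)%N else 0))).
  rewrite -(big_mkord xpredT (fun k => a k * b (i - j - k)%N)).
  rewrite (big_cat_nat (n := (i - j).+1)) //=; last by lia.
  rewrite [X in _ + X]big_nat_cond [X in _ + X]big1 ?addr0.
    rewrite big_nat_cond [RHS]big_nat_cond; apply: eq_bigr => k hk.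
    by rewrite ifT; [congr (_ * b _)|]; lia.
  by move=> k hk; rewrite ifF ?mulr0 //; lia.
by apply: big1 => k _; rewrite ifF ?mulr0 //; lia.
Qed.

Lemma convD a b b' i : conv a (fun k => b k + b' k) i = conv a b i + conv a b' i.
Proof. by rewrite /conv -big_split; apply: eq_bigr => k _; rewrite mulrDr. Qed.

Lemma convZ c a b i : conv a (fun k => c * b k) i = c * conv a b i.
Proof. by rewrite /conv mulr_sumr; apply: eq_bigr => k _; rewrite mulrCA. Qed.

(** Isolates the two extreme terms, the only ones containing coefficients of index [i]. The
    remaining sum has the form used in [rhs]. *)
Lemma convS a b i : (0 < i)%N ->
  conv a b i = a 0 * b i + a i * b 0 + \sum_(1 <= k < i) a (i - k)%N * b k.
Proof.
case: i => // i _; rewrite /conv big_ord_recl big_ord_recr /= subn0 subnn.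
rewrite -addrA [X in _ + X]addrC; congr (_ + (_ + _)).
rewrite (big_addn 0 _ 1) subn1 /= big_nat_rev big_mkord.
by apply: eq_bigr => k _; congr (a _ * b _); rewrite /= /bump; have := ltn_ord k; lia.
Qed.

(** The truncated bound makes the sum empty when [i < j], as the convention on negative indices
    requires. *)
Lemma before_conv a b i j : before (conv a b) i j =
  \sum_(0 <= k < i.+1 - j) a (i - j - k)%N * b k.
Proof.
rewrite /before; case: leqP => ji; last by rewrite big_geq //; lia.
rewrite /conv -(big_mkord xpredT (fun k => a k * b (i - j - k)%N)) big_nat_rev subSn //=.
rewrite big_nat_cond [RHS]big_nat_cond.
by apply: eq_bigr => k hk; congr (a _ * b _); lia.
Qed.

End CoefL.

(** * The differential system as recurrences and as linear steps *)

Lemma and33_iff (A1 A2 A3 A4 A5 A6 B1 B2 B3 B4 B5 B6 : Prop) :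
  (A1 <-> B1) -> (A2 <-> B2) -> (A3 <-> B3) ->
  (A4 <-> B4) -> (A5 <-> B5) -> (A6 <-> B6) ->
  [/\ A1, A2 & A3] /\ [/\ A4, A5 & A6] <-> [/\ B1, B2 & B3] /\ [/\ B4, B5 & B6].
Proof. by firstorder. Qed.

(** Reduces moving terms across an equation to one identity that [ring] can check. *)
Lemma eq_iff_sub (V : zmodType) (x y x' y' : V) : x - y = x' - y' -> x = y <-> x' = y'.
Proof.
by move=> h; split=> e; apply/subr0_eq; [rewrite -h|rewrite h]; rewrite e subrr.
Qed.

Section Recurrence.
Variables (C : fieldType) (d2 : nat).
Implicit Type s : coeffs C.

(** The six equations compared coefficientwise, before the unknowns of index [i] are gathered on the
    left. *)
Definition recurrence_at s (i : nat) : Prop :=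
  [/\ i%:R * a1_ s i = - 2 * before (conv (a1_ s) (c1_ s)) i 2,
      (i%:R + 2) * a2_ s i =
        - 4 * before (conv (a2_ s) (c1_ s)) i 2 - 2 * conv (a2_ s) (c2_ s) i &
      (i%:R + 1) * b_ s i = conv (b_ s) (e_ s) i] /\
  [/\ (i%:R + 1) * c1_ s i =
        - conv (c1_ s) (e_ s) i + d2%:R^-1 * (a1_ s i + 2 * before (a2_ s) i 2),
      (i%:R - 1) * c2_ s i = - conv (c2_ s) (e_ s) i + before (a2_ s) i 4 &
      (i%:R - 1) * e_ s i =
        - d2%:R * before (conv (c1_ s) (c1_ s)) i 4 - conv (c2_ s) (c2_ s) i].


(** Each equation is read from the exponent where the derivative on its left starts: -1, 1, 0, 0,
    -2, -2. The order of every other term relative to it gives the shifts 0, 2 and 4. *)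
Lemma formal_solutionP s : formal_solution d2 s <-> forall i, recurrence_at s i.
Proof.
have bef0 (a : nat -> C) i : before a i 0 = a i by rewrite /before subn0.
have dshift (f : laurent C) (m m' : int) (j i : nat) :
    m + 1 = m' -> lorder f = m' + j%:Z ->
    coefL (derivL f) (m + i%:Z) = (m' + i%:Z)%:~R * before (lcoef f) i j.
  move=> <- h; rewrite coefL_deriv -addrA [i%:Z + 1]addrC addrA.
  by rewrite (coefL_before _ h).
have E1 : leqv (derivL (x1 s)) (scaleL (- 2) (mulL (x1 s) (v1 s))) <->
    forall i : nat, i%:R * a1_ s i = - 2 * before (conv (a1_ s) (c1_ s)) i 2.
  rewrite (@leqv_shift _ _ _ (- 1)); first last.
  - by move=> n hn; rewrite coefL_lt //=; lia.
  - by move=> n hn; rewrite coefL_lt //=; lia.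
  have Q i : coefL (derivL (x1 s)) (- 1 + i%:Z) = i%:R * a1_ s i.
    by rewrite (@dshift _ _ 0 0) // bef0 add0r.
  have Q' i : coefL (scaleL (- 2) (mulL (x1 s) (v1 s))) (- 1 + i%:Z) =
      - 2 * before (conv (a1_ s) (c1_ s)) i 2.
    by rewrite coefL_scale (@coefL_before _ _ _ 2).
  by split=> h i; move: (h i); rewrite Q Q'.
have E2 : leqv (derivL (x2 s)) (scaleL (- 2) (mulL (x2 s) (addL (scaleL 2 (v1 s)) (v2 s)))) <->
    forall i : nat, (i%:R + 2) * a2_ s i =
        - 4 * before (conv (a2_ s) (c1_ s)) i 2 - 2 * conv (a2_ s) (c2_ s) i.
  rewrite (@leqv_shift _ _ _ 1); first last.
  - by move=> n hn; rewrite coefL_lt //=; lia.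
  - by move=> n hn; rewrite coefL_lt //=; lia.
  have Q i : coefL (derivL (x2 s)) (1 + i%:Z) = (i%:R + 2) * a2_ s i.
    by rewrite (@dshift _ _ 2 0) // bef0 rmorphD /= addrC.
  have Q' i : coefL (scaleL (- 2) (mulL (x2 s) (addL (scaleL 2 (v1 s)) (v2 s)))) (1 + i%:Z) =
      - 4 * before (conv (a2_ s) (c1_ s)) i 2 - 2 * conv (a2_ s) (c2_ s) i.
    rewrite coefL_scale (@coefL_before _ _ _ 0) // bef0.
    rewrite -[lcoef _ i]/(conv (a2_ s) (lcoef (addL (scaleL 2 (v1 s)) (v2 s))) i).
    (* The sum [2 v1 + v2] starts at order -1, that of [v2]; hence [c1_] enters shifted by 2. *)
    have -> : conv (a2_ s) (lcoef (addL (scaleL 2 (v1 s)) (v2 s))) i =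
        conv (a2_ s) (fun k => 2 * before (c1_ s) k 2 + c2_ s k) i.
      apply: eq_bigr => k _; congr (_ * _); rewrite /= coefL_scale.
      by rewrite (@coefL_before _ _ _ 2) // (@coefL_before _ _ _ 0) // bef0.
    by rewrite convD convZ conv_before; ring.
  by split=> h i; move: (h i); rewrite Q Q'.
have E3 : leqv (derivL (x3 s)) (mulL (x3 s) (v3 s)) <->
    forall i : nat, (i%:R + 1) * b_ s i = conv (b_ s) (e_ s) i.
  rewrite (@leqv_shift _ _ _ 0); first last.
  - by move=> n hn; rewrite coefL_lt //=; lia.
  - by move=> n hn; rewrite coefL_lt //=; lia.
  have Q i : coefL (derivL (x3 s)) (0 + i%:Z) = (i%:R + 1) * b_ s i.
    by rewrite (@dshift _ _ 1 0) // bef0 rmorphD /= addrC.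
  have Q' i : coefL (mulL (x3 s) (v3 s)) (0 + i%:Z) = conv (b_ s) (e_ s) i.
    by rewrite (@coefL_before _ _ _ 0) // bef0.
  by split=> h i; move: (h i); rewrite Q Q'.
have E4 : leqv (derivL (v1 s)) (addL (scaleL (- 1) (mulL (v1 s) (v3 s)))
       (scaleL d2%:R^-1 (addL (x1 s) (scaleL 2 (x2 s))))) <->
    forall i : nat, (i%:R + 1) * c1_ s i =
      - conv (c1_ s) (e_ s) i + d2%:R^-1 * (a1_ s i + 2 * before (a2_ s) i 2).
  rewrite (@leqv_shift _ _ _ 0); first last.
  - by move=> n hn; rewrite coefL_lt //=; lia.
  - by move=> n hn; rewrite coefL_lt //=; lia.
  have Q i : coefL (derivL (v1 s)) (0 + i%:Z) = (i%:R + 1) * c1_ s i.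
    by rewrite (@dshift _ _ 1 0) // bef0 rmorphD /= addrC.
  have Q' i : coefL (addL (scaleL (- 1) (mulL (v1 s) (v3 s)))
       (scaleL d2%:R^-1 (addL (x1 s) (scaleL 2 (x2 s))))) (0 + i%:Z) =
      - conv (c1_ s) (e_ s) i + d2%:R^-1 * (a1_ s i + 2 * before (a2_ s) i 2).
    rewrite !(coefL_scale, coefL_add).
    rewrite (@coefL_before _ _ _ 0) // (@coefL_before _ (x1 s) _ 0) //.
    by rewrite (@coefL_before _ (x2 s) _ 2) // !bef0 mulN1r.
  by split=> h i; move: (h i); rewrite Q Q'.
have E5 : leqv (derivL (v2 s)) (addL (scaleL (- 1) (mulL (v2 s) (v3 s))) (x2 s)) <->
    forall i : nat, (i%:R - 1) * c2_ s i = - conv (c2_ s) (e_ s) i + before (a2_ s) i 4.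
  rewrite (@leqv_shift _ _ _ (- 2)); first last.
  - by move=> n hn; rewrite coefL_lt //=; lia.
  - by move=> n hn; rewrite coefL_lt //=; lia.
  have Q i : coefL (derivL (v2 s)) (- 2 + i%:Z) = (i%:R - 1) * c2_ s i.
    by rewrite (@dshift _ _ (- 1) 0) // bef0 rmorphD /= addrC.
  have Q' i : coefL (addL (scaleL (- 1) (mulL (v2 s) (v3 s))) (x2 s)) (- 2 + i%:Z) =
      - conv (c2_ s) (e_ s) i + before (a2_ s) i 4.
    rewrite !(coefL_scale, coefL_add) (@coefL_before _ _ _ 0) //.
    by rewrite (@coefL_before _ (x2 s) _ 4) // !bef0 mulN1r.
  by split=> h i; move: (h i); rewrite Q Q'.
have E6 : leqv (derivL (v3 s)) (addL (scaleL (- 1) (scaleL d2%:R (mulL (v1 s) (v1 s))))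
        (scaleL (- 1) (mulL (v2 s) (v2 s)))) <->
    forall i : nat, (i%:R - 1) * e_ s i =
        - d2%:R * before (conv (c1_ s) (c1_ s)) i 4 - conv (c2_ s) (c2_ s) i.
  rewrite (@leqv_shift _ _ _ (- 2)); first last.
  - by move=> n hn; rewrite coefL_lt //=; lia.
  - by move=> n hn; rewrite coefL_lt //=; lia.
  have Q i : coefL (derivL (v3 s)) (- 2 + i%:Z) = (i%:R - 1) * e_ s i.
    by rewrite (@dshift _ _ (- 1) 0) // bef0 rmorphD /= addrC.
  have Q' i : coefL (addL (scaleL (- 1) (scaleL d2%:R (mulL (v1 s) (v1 s))))
        (scaleL (- 1) (mulL (v2 s) (v2 s)))) (- 2 + i%:Z) =
      - d2%:R * before (conv (c1_ s) (c1_ s)) i 4 - conv (c2_ s) (c2_ s) i.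
    rewrite !(coefL_scale, coefL_add) (@coefL_before _ _ _ 4) //.
    by rewrite (@coefL_before _ (mulL (v2 s) _) _ 0) // bef0 !mulN1r mulNr.
  by split=> h i; move: (h i); rewrite Q Q'.
rewrite /formal_solution (and33_iff E1 E2 E3 E4 E5 E6).
split=> [[[h1 h2 h3] [h4 h5 h6]] i|h]; first by [].
by split; split=> i; case: (h i) => [[? ? ?] [? ? ?]].
Qed.

Lemma colP6 (u w : 'cV[C]_6) : u = w <->
  [/\ u (inord 0) 0 = w (inord 0) 0, u (inord 1) 0 = w (inord 1) 0 &
      u (inord 2) 0 = w (inord 2) 0] /\
  [/\ u (inord 3) 0 = w (inord 3) 0, u (inord 4) 0 = w (inord 4) 0 &
      u (inord 5) 0 = w (inord 5) 0].
Proof.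
split=> [->//|[[h0 h1 h2] [h3 h4 h5]]]; apply/colP => k; rewrite -[k]inord_val.
by case: k => [[|[|[|[|[|[|]]]]]] kP].
Qed.

Lemma mulX_col s (z : int) (u : 'cV[C]_6) :
  let zz : C := z%:~R in let U k := u (inord k) 0 in
  X d2 s z *m u = \col_(r < 6) nth 0
    [:: zz * U 0; zz * U 1 + 2 * a2_ s 0 * U 4; zz * U 2 - b_ s 0 * U 5;
        - d2%:R^-1 * U 0 + (zz + 2) * U 3 + c1_ s 0 * U 5;
        zz * U 4 - U 5; - 2 * U 4 + (zz - 1) * U 5] r.
Proof.
move=> zz U; have UE (k : 'I_6) : u k 0 = U k by rewrite /U inord_val.
apply/colP => k; rewrite !mxE !big_ord_recl big_ord0 !mxE !UE /=.
by case: k => [[|[|[|[|[|[|]]]]]] kP] //=; rewrite /bump /= -/zz; ring.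
Qed.

Lemma mulXP s (z : int) (u r : 'cV[C]_6) : let zz : C := z%:~R in
  let U k := u (inord k) 0 in let V k := r (inord k) 0 in
  X d2 s z *m u = r <->
  [/\ zz * U 0 = V 0, zz * U 1 + 2 * a2_ s 0 * U 4 = V 1 &
      zz * U 2 - b_ s 0 * U 5 = V 2] /\
  [/\ - d2%:R^-1 * U 0 + (zz + 2) * U 3 + c1_ s 0 * U 5 = V 3,
      zz * U 4 - U 5 = V 4 & - 2 * U 4 + (zz - 1) * U 5 = V 5].
Proof. by move=> zz U V; rewrite mulX_col colP6 !mxE !inordK. Qed.

(** By [convS], the extreme terms of each Cauchy product, with [c_{2,0} = -1] and [e_0 = 1]
    substituted, move to the left and form [X]; the inner sums form [rhs]. *)
Lemma stepP s i : c2_ s 0 = -1 -> e_ s 0 = 1 -> (0 < i)%N ->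
  step d2 s i <-> recurrence_at s i.
Proof.
move=> c20 e0 i_gt0; rewrite /step /recurrence_at mulXP !mxE !inordK //= -pmulrn.
have i2 : (i - 1 = i.+1 - 2)%N by lia.
have i4 : (i - 3 = i.+1 - 4)%N by lia.
rewrite i2 i4 -!before_conv !(convS _ _ i_gt0) c20 e0.
by apply: and33_iff; apply: eq_iff_sub; ring.
Qed.

(** The prescribed leading coefficients balance the dominant terms; for instance
    [2 c_{1,0} = a_{1,0} / d_2]. *)
Lemma recurrence0 a10 a20 b0 s : d2%:R != 0 :> C -> 2 != 0 :> C ->
  initial d2 a10 a20 b0 s -> recurrence_at s 0.
Proof.
move=> d_neq0 two_neq0 [[h1 h2 h3] [h4 h5 h6]].
rewrite /recurrence_at /before /conv /= !big_ord1 subnn h1 h2 h3 h4 h5 h6.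
split; split; try ring; field.
by rewrite d_neq0.
Qed.

Lemma formal_solution_step a10 a20 b0 s : d2%:R != 0 :> C -> 2 != 0 :> C ->
  initial d2 a10 a20 b0 s ->
  formal_solution d2 s <-> forall i, (0 < i)%N -> step d2 s i.
Proof.
move=> d_neq0 two_neq0 init_s; have [_ [_ c20 e0]] := init_s.
rewrite formal_solutionP; split=> [h i i_gt0|h [|i]]; first exact/stepP.
  exact: recurrence0 init_s.
by apply/stepP => //; apply: h.
Qed.

(** * Singular matrices and the kernel of [X] *)

Lemma det_mx_colP n (A : 'M[C]_n) :
  reflect (exists2 u : 'cV[C]_n, u != 0 & A *m u = 0) (\det A == 0).
Proof.
rewrite -det_tr; apply: (iffP det0P) => -[u u_neq0 uA].
  by exists u^T; rewrite ?trmx_eq0 // -[A]trmxK -trmx_mul uA trmx0.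
by exists u^T; rewrite ?trmx_eq0 // -trmx_mul uA trmx0.
Qed.

(** The last two rows involve only the [c_2] and [e] entries and form a block of determinant
    [z(z - 1) - 2 = (z - 2)(z + 1)]. Once these entries and the [a_1] entry vanish, the other rows
    are diagonal with entries [z], [z], [z + 2]. *)
Lemma kerX s (z : int) (u : 'cV[C]_6) :
  z%:~R != 0 :> C -> z%:~R + 2 != 0 :> C -> (z%:~R - 2) * (z%:~R + 1) != 0 :> C ->
  X d2 s z *m u = 0 -> u = 0.
Proof.
move=> z0 z2 zr /mulXP; rewrite !mxE => -[[h0 h1 h2] [h3 h4 h5]].
apply/colP6; rewrite !mxE.
have e0 : u (inord 0) 0 = 0 by apply: (mulfI z0); rewrite h0 mulr0.
have e4 : u (inord 4) 0 = 0.
  apply: (mulfI zr); rewrite mulr0.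
  (* This combination of the last two rows eliminates the [e] entry. *)
  have -> : (z%:~R - 2) * (z%:~R + 1) * u (inord 4) 0 =
      (z%:~R - 1) * (z%:~R * u (inord 4) 0 - u (inord 5) 0) +
      (- 2 * u (inord 4) 0 + (z%:~R - 1) * u (inord 5) 0) by ring.
  by rewrite h4 h5 mulr0 addr0.
have e5 : u (inord 5) 0 = 0 by apply/eqP; rewrite -oppr_eq0 -h4 e4 mulr0 add0r.
move: h1 h2 h3; rewrite e0 e4 e5 !mulr0 !addr0 subr0 add0r => h1 h2 h3.
by do !split=> //; [apply: (mulfI z0)|apply: (mulfI z0)|apply: (mulfI z2)]; rewrite mulr0.
Qed.

(** * Power series modulo [X^N] as truncated polynomials *)

Definition trunc N (a : nat -> C) : {poly C} := \poly_(i < N) a i.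

(** Congruence modulo [X^N] is given by an explicit cofactor, so that it can be rewritten with and
    handled by [ring]. *)
Lemma truncP N (p q : {poly C}) :
  (forall i, (i < N)%N -> p`_i = q`_i) -> exists r, p = q + 'X^N * r.
Proof.
move=> pq; exists (drop_poly N (p - q)).
rewrite -{1}[p](subrK q) addrC; congr (_ + _).
rewrite -{1}[p - q](poly_take_drop N) mulrC.
suff -> : take_poly N (p - q) = 0 by rewrite add0r.
apply/polyP => i; rewrite coef_take_poly coef0; case: ltnP => // iN.
by rewrite coefB pq // subrr.
Qed.

Lemma coef_truncM N (a b : nat -> C) i : (i < N)%N ->
  (trunc N a * trunc N b)`_i = conv a b i.
Proof.
move=> iN; rewrite coefM; apply: eq_bigr => j _.
by rewrite !coef_poly !ifT //; have := ltn_ord j; lia.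
Qed.

Lemma coefXn_before j (p : {poly C}) (a : nat -> C) N i :
  (forall k, (k < N)%N -> p`_k = a k) -> (i < N)%N -> ('X^j * p)`_i = before a i j.
Proof.
move=> pa iN; rewrite coefXnM /before; case: ltnP => ji; rewrite ?ltnNge ?ji //=.
by apply: pa; lia.
Qed.

(** The Euler operator [X d/dX] acts diagonally on coefficients, without the index shift of the
    plain derivative. *)
Lemma coef_Xderiv (p : {poly C}) i : ('X * p^`())`_i = i%:R * p`_i.
Proof. by rewrite coefXM; case: i => [|i]; rewrite ?mul0r //= coef_deriv mulr_natl. Qed.
End Recurrence.

(** * The energy as a first integral *)

Section FirstIntegral.
Variables (C : numFieldType) (d2 : nat).
Implicit Type s : coeffs C.

(** The coefficient of [t^(i - 2)] in the second factor of [H]: the series starts at [t^(-2)],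
    because of [v_2^2] and [v_3^2], and its constant 1 sits at [i = 2]. *)
Definition energy_coef s (i : nat) : C :=
  d2%:R * before (conv (c1_ s) (c1_ s)) i 4 + conv (c2_ s) (c2_ s) i
  - conv (e_ s) (e_ s) i + before (a1_ s) i 2 + before (a2_ s) i 4 + (i == 2%N)%:R.

Lemma on_H0P s : on_H0 d2 s <-> forall i, energy_coef s i = 0.
Proof.
have bef0 (a : nat -> C) i : before a i 0 = a i by rewrite /before subn0.
have const0 n : coefL (constL (0 : C)) n = 0.
  by rewrite /coefL /= !if_same.
rewrite /on_H0 (@leqv_shift _ _ _ (- 2)); first last.
- by move=> n _; rewrite const0.
- by move=> n hn; rewrite coefL_lt //=; lia.
have Q i : coefL (d2%:R *: (v1 s * v1 s) + v2 s * v2 s - v3 s * v3 s + x1 s + x2 s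
    + constL 1)%L (- 2 + i%:Z) = energy_coef s i.
  rewrite !(coefL_add, coefL_scale) (@coefL_before _ (mulL (v1 s) _) _ 4) //.
  rewrite (@coefL_before _ (mulL (v2 s) _) _ 0) // (@coefL_before _ (mulL (v3 s) _) _ 0) //.
  rewrite (@coefL_before _ (x1 s) _ 2) // (@coefL_before _ (x2 s) _ 4) //.
  rewrite (@coefL_before _ (constL 1) _ 2) // !bef0 mulN1r; congr (_ + _).
  rewrite /before /=; case: (leqP 2 i) => i2; last by rewrite (_ : (i == 2%N) = false) //; lia.
  by rewrite -(eqn_add2r 2) subnK //; case: (i == 2%N).
by split=> h i; move: (h i); rewrite Q const0.
Qed.

(* The energy is a first integral of the system: with [theta = X d/dX] and [G]
   the energy multiplied by [X^2], the equations give [theta G = 2 G], hence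
   [(i - 2) G_i = 0].  This is checked on truncations modulo [X^N]. *)
Lemma energy_coef_eq0 s (i : nat) : d2%:R != 0 :> C ->
  (forall i, recurrence_at d2 s i) -> i != 2%N -> energy_coef s i = 0.
Proof.
move=> d_neq0 rec_s i_neq2; pose N := i.+1.
pose A1 := trunc N (a1_ s); pose A2 := trunc N (a2_ s).
pose C1 := trunc N (c1_ s); pose C2 := trunc N (c2_ s); pose E := trunc N (e_ s).
pose D : {poly C} := d2%:R%:P.
have tr (a : nat -> C) k : (k < N)%N -> (trunc N a)`_k = a k by move=> kN; rewrite coef_poly kN.
have trM (a b : nat -> C) k : (k < N)%N -> (trunc N a * trunc N b)`_k = conv a b k.
  exact: coef_truncM.
have [r1 e1] : exists r, 'X * A1^`() = - 2%:P * ('X^2 * (A1 * C1)) + 'X^N * r.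
  apply: truncP => k kN; rewrite coef_Xderiv tr // mulNr coefN coefCM.
  by rewrite (coefXn_before 2 (trM _ _)) // -mulNr; case: (rec_s k) => -[].
have [r2 e2] : exists r, 'X * A2^`() =
    - 2%:P * A2 - 4%:P * ('X^2 * (A2 * C1)) - 2%:P * (A2 * C2) + 'X^N * r.
  apply: truncP => k kN; rewrite coef_Xderiv tr // !mulNr !(coefD, coefN) !coefCM.
  rewrite (coefXn_before 2 (trM _ _)) // trM // tr //.
  (* The recurrence has the factor [k + 2], from the order of [x2], where the Euler operator gives
     [k]; the difference is added to both sides. The next three congruences are corrected in the
     same way. *)
  case: (rec_s k) => -[_ h _] _; apply: (addIr (2 * a2_ s k)).
  by rewrite -mulrDl h; ring.
(* Multiplying by [d_2] clears the inverse and matches the factor [d_2] of [v_1^2] in the energy. *)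
have [r4 e4] : exists r, D * ('X * C1^`()) =
    - D * C1 - D * (C1 * E) + A1 + 2%:P * ('X^2 * A2) + 'X^N * r.
  apply: truncP => k kN; rewrite !mulNr !(coefD, coefN) !coefCM coef_Xderiv.
  rewrite (coefXn_before 2 (tr _)) // trM // !tr //.
  case: (rec_s k) => _ [h _ _]; apply: (addIr (d2%:R * c1_ s k)).
  by rewrite -mulrDr -{2}[c1_ s k]mul1r -mulrDl h; field.
have [r5 e5] : exists r, 'X * C2^`() = C2 - C2 * E + 'X^4 * A2 + 'X^N * r.
  apply: truncP => k kN; rewrite coef_Xderiv !(coefD, coefN).
  rewrite (coefXn_before 4 (tr _)) // trM // !tr //.
  case: (rec_s k) => _ [_ h _]; apply: (addIr (- c2_ s k)).
  by rewrite -[X in _ - X]mul1r -mulrBl h; ring.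
have [r6 e6] : exists r, 'X * E^`() = E - D * ('X^4 * (C1 * C1)) - C2 * C2 + 'X^N * r.
  apply: truncP => k kN; rewrite coef_Xderiv !(coefD, coefN) coefCM.
  rewrite (coefXn_before 4 (trM _ _)) // trM // !tr //.
  case: (rec_s k) => _ [_ _ h]; apply: (addIr (- e_ s k)).
  by rewrite -[X in _ - X]mul1r -mulrBl h; ring.
pose G := D * ('X^4 * (C1 * C1)) + C2 * C2 - E * E + 'X^2 * A1 + 'X^4 * A2 + 'X^2.
have GE : G`_i = energy_coef s i.
  rewrite !(coefD, coefN) coefCM (coefXn_before 4 (trM _ _)) //.
  rewrite (coefXn_before 2 (tr _)) // (coefXn_before 4 (tr _)) // !trM //.
  by rewrite coefXn.
(* The product rule, grouped so that the left sides of [e1], [e2], [e4], [e5] and [e6] occur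
   literally. *)
have dG : 'X * G^`() = 4%:P * D * ('X^4 * (C1 * C1)) + 2%:P * 'X^4 * C1 * (D * ('X * C1^`()))
    + 2%:P * C2 * ('X * C2^`()) - 2%:P * E * ('X * E^`())
    + 2%:P * 'X^2 * A1 + 'X^2 * ('X * A1^`()) + 4%:P * 'X^4 * A2 + 'X^4 * ('X * A2^`())
    + 2%:P * 'X^2.
  rewrite /G /D !derivE /=; ring.
have [r hG] : exists r, 'X * G^`() = 2%:P * G + 'X^N * r.
  (* The cofactors enter with the multipliers that their derivatives have in [dG]. *)
  exists (2%:P * 'X^4 * C1 * r4 + 2%:P * C2 * r5 - 2%:P * E * r6 + 'X^2 * r1 + 'X^4 * r2).
  rewrite dG e1 e2 e4 e5 e6 /G; ring.
move/(congr1 (fun p : {poly C} => p`_i)): hG.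
(* Since [i < N], the error term does not reach index [i], which leaves [i G_i = 2 G_i]. *)
rewrite coef_Xderiv GE coefD coefCM coefXnM ltnSn addr0 GE => /eqP.
rewrite -subr_eq0 -mulrBl mulf_eq0 subr_eq0 eqr_nat (negPf i_neq2) /=.
by move/eqP.
Qed.

(** Index 2 is the one where [(i - 2) G_i = 0] says nothing, so the coefficient is computed
    directly. *)
Lemma energy_coef2 s a10 a20 b0 : initial d2 a10 a20 b0 s ->
  c2_ s 1 = 0 -> e_ s 1 = 0 ->
  energy_coef s 2 = - 2 * c2_ s 2 - 2 * e_ s 2 + a10 + 1.
Proof.
move=> [[h1 _ _] [_ h5 h6]] c21 e1.
rewrite /energy_coef /before /= /conv !big_ord_recl !big_ord0 /= /bump /= !subnn !subn0.
by rewrite h1 h5 h6 c21 e1; ring.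
Qed.

End FirstIntegral.

(** * Location of the resonances and recursion beyond them *)

Section Resonances.
Variables (C : numFieldType) (d2 : nat).
Implicit Types (s : coeffs C) (i : nat).

Lemma kerX_int s (j : int) (u : 'cV[C]_6) :
  j != 0 -> j != -1 -> j != 2 -> j != -2 -> X d2 s j *m u = 0 -> u = 0.
Proof.
move=> j0 j1 j2 j2'; apply: kerX; first by rewrite intr_eq0.
  by rewrite -[2]/(2%:~R) -intrD intr_eq0; lia.
rewrite -[2]/(2%:~R) -[1]/(1%:~R) -intrB -intrD -intrM intr_eq0 mulf_eq0; lia.
Qed.

Lemma resonance_le2 s (j : int) : resonance d2 s j -> j <= 2.
Proof.
move=> /eqP/det_mx_colP[u u_neq0 Xu]; case: lerP => // j_gt2; case/eqP: u_neq0.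
by apply: (kerX_int (s := s) (j := j)) => //; lia.
Qed.

Lemma X_unitmx s i : (2 < i)%N -> X d2 s i%:Z \in unitmx.
Proof.
by move=> i2; rewrite unitmxE unitfE; apply/eqP => /resonance_le2; lia.
Qed.

Lemma vecP s s' k : vec s k = vec s' k <->
  [/\ a1_ s k = a1_ s' k, a2_ s k = a2_ s' k & b_ s k = b_ s' k] /\
  [/\ c1_ s k = c1_ s' k, c2_ s k = c2_ s' k & e_ s k = e_ s' k].
Proof. by rewrite colP6 !mxE !inordK. Qed.

Lemma X_local s s' : vec s 0 = vec s' 0 -> X d2 s =1 X d2 s'.
Proof. by move=> /vecP[[_ h2 h3] [h4 _ _]] j; rewrite /X h2 h3 h4. Qed.

(** Makes the steps a genuine recursion: [R_i] depends only on coefficients of index below [i]. *)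
Lemma rhs_local s s' i : (0 < i)%N ->
  (forall k, (k < i)%N -> vec s k = vec s' k) -> rhs d2 s i = rhs d2 s' i.
Proof.
move=> i_gt0 ss'.
have e1 k : (k < i)%N -> a1_ s k = a1_ s' k by move=> /ss'/vecP[[]].
have e2 k : (k < i)%N -> a2_ s k = a2_ s' k by move=> /ss'/vecP[[]].
have e3 k : (k < i)%N -> b_ s k = b_ s' k by move=> /ss'/vecP[[]].
have e4 k : (k < i)%N -> c1_ s k = c1_ s' k by move=> /ss'/vecP[_ []].
have e5 k : (k < i)%N -> c2_ s k = c2_ s' k by move=> /ss'/vecP[_ []].
have e6 k : (k < i)%N -> e_ s k = e_ s' k by move=> /ss'/vecP[_ []].
(* The condition [0 < j + m] keeps each index [i - j - k] strictly below [i]. *)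
have sum_local (f f' g g' : nat -> C) m n j :
    (forall k, (k < i)%N -> f k = f' k) -> (forall k, (k < i)%N -> g k = g' k) ->
    (n <= i)%N -> (0 < j + m)%N ->
    \sum_(m <= k < n) f (i - j - k)%N * g k = \sum_(m <= k < n) f' (i - j - k)%N * g' k.
  move=> ff' gg' ni jm; apply: eq_big_nat => k /andP[mk kn].
  by rewrite ff' ?gg' //; lia.
have sum_local0 (f f' g g' : nat -> C) :
    (forall k, (k < i)%N -> f k = f' k) -> (forall k, (k < i)%N -> g k = g' k) ->
    \sum_(1 <= k < i) f (i - k)%N * g k = \sum_(1 <= k < i) f' (i - k)%N * g' k.
  by move=> ff' gg'; have := sum_local f f' g g' 1 i 0 ff' gg' (leqnn _) isT; rewrite subn0.
have bef j : (0 < j)%N -> before (a2_ s) i j = before (a2_ s') i j.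
  by move=> j0; rewrite /before; case: ifP => // ji; rewrite e2 //; lia.
rewrite /rhs (sum_local _ _ _ _ _ _ _ e1 e4) // ?leq_subr //.
rewrite (sum_local _ _ _ _ _ _ _ e2 e4) // ?leq_subr //.
rewrite (sum_local _ _ _ _ _ _ _ e4 e4) // ?leq_subr //.
rewrite (sum_local0 _ _ _ _ e2 e5) (sum_local0 _ _ _ _ e3 e6) (sum_local0 _ _ _ _ e4 e6).
by rewrite (sum_local0 _ _ _ _ e5 e6) (sum_local0 _ _ _ _ e5 e5) !bef.
Qed.

(** Inverse to [vec]: the recursion produces columns, from which the six sequences are read. *)
Definition coeffs_of (f : nat -> 'cV[C]_6) : coeffs C :=
  Coeffs (fun k => f k (inord 0) 0) (fun k => f k (inord 1) 0)
         (fun k => f k (inord 2) 0) (fun k => f k (inord 3) 0)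
         (fun k => f k (inord 4) 0) (fun k => f k (inord 5) 0).

Lemma vec_coeffs_of f k : vec (coeffs_of f) k = f k.
Proof. by apply/colP6; rewrite !mxE !inordK. Qed.

Lemma course_of_values T (F : (nat -> T) -> nat -> T) : T ->
  (forall f g i, (forall k, (k < i)%N -> f k = g k) -> F f i = F g i) ->
  exists f, forall i, f i = F f i.
Proof.
move=> t0 F_local.
(* The table [g n] holds the values of index below [n] and the default [t0] elsewhere; by locality
   the default does not affect [F (g n) n]. *)
pose g := fix g n k := if n is n'.+1 then
  if k == n' then F (g n') n' else g n' k else t0.
have gE n k : (k < n)%N -> g n k = F (g k) k.
  elim: n => // n IH; rewrite ltnS leq_eqVlt /=; case: eqP => [->//|_ /=].
  exact: IH.
exists (fun k => F (g k) k) => i; apply: F_local => k ki; exact: gE.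
Qed.

Lemma extend_steps (s : coeffs C) : exists s' : coeffs C,
  (forall k, (k <= 2)%N -> vec s' k = vec s k) /\
  (forall i, (2 < i)%N -> step d2 s' i).
Proof.
(* The matrix may be taken at the given [s]: it depends only on coefficients of index 0, which the
   extension keeps. *)
pose F (f : nat -> 'cV[C]_6) i := if (i <= 2)%N then vec s i
  else invmx (X d2 s i%:Z) *m rhs d2 (coeffs_of f) i.
have [f fE] : exists f, forall i, f i = F f i.
  apply: course_of_values 0 _ => f g i fg; rewrite /F; case: leqP => // i2.
  by congr (_ *m _); apply: rhs_local => [|k ki]; [lia|rewrite !vec_coeffs_of fg].
exists (coeffs_of f); split=> [k k2|i i2]; first by rewrite vec_coeffs_of fE /F k2.
rewrite /step vec_coeffs_of fE /F leqNgt i2 /= (@X_local _ s).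
  by rewrite mulKVmx // X_unitmx.
by rewrite vec_coeffs_of fE.
Qed.

Lemma rhs1 s : rhs d2 s 1 = 0.
Proof.
apply/colP6; rewrite !mxE !inordK //= /before /= !big_geq //.
by rewrite !(mulr0, oppr0, addr0).
Qed.

(** All terms of [R_1] vanish, and 1 is not a resonance. *)
Lemma step1P s : step d2 s 1 <-> vec s 1 = 0.
Proof.
rewrite /step rhs1; split=> [|->]; last by rewrite mulmx0.
exact: kerX_int.
Qed.

Lemma vec_eq0 s k : vec s k = 0 <->
  [/\ a1_ s k = 0, a2_ s k = 0 & b_ s k = 0] /\
  [/\ c1_ s k = 0, c2_ s k = 0 & e_ s k = 0].
Proof. by rewrite colP6 !mxE !inordK. Qed.

End Resonances.

(** * The solution line at [i = 2] and the choice of its parameter *)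

Section TopResonance.
Variables (C : numFieldType) (d2 : nat) (a10 a20 b0 : C).
Hypothesis d2_gt0 : (0 < d2)%N.
Implicit Types (s : coeffs C).

Local Notation c10 := (a10 / (2 * d2%:R)).

(** The particular solution at [i = 2] whose [c_2] entry is 0. *)
Definition res_point : 'cV[C]_6 :=
  \col_(r < 6) nth 0 [:: - a10 * c10; - 2 * a20 * c10; 0;
                         (2 * a20 - a10 * c10) / (4 * d2%:R); 0; 0] r.

(** The kernel direction of [X(2)] normalised to [c_2] entry 1, so that the free parameter is
    [z = c_{2,2}]. *)
Definition res_dir : 'cV[C]_6 :=
  \col_(r < 6) nth 0 [:: 0; - a20; b0; - c10 / 2; 1; 2] r.

Let d_neq0 : d2%:R != 0 :> C. Proof. by rewrite pnatr_eq0 -lt0n. Qed.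
Let two_neq0 : 2 != 0 :> C. Proof. by rewrite pnatr_eq0. Qed.

Lemma res_dir_neq0 : res_dir != 0.
Proof.
by apply/eqP => /colP6[_ []]; rewrite !mxE !inordK //= => _ /eqP; rewrite oner_eq0.
Qed.

(** Coefficients of index 1 vanish, which kills every sum starting at [k = 1]. The two final zeros
    give compatibility, since the last two rows of [X(2)] are opposite. *)
Lemma rhs2 s : initial d2 a10 a20 b0 s -> step d2 s 1 ->
  rhs d2 s 2 = \col_(r < 6) nth 0
    [:: - 2 * a10 * c10; - 4 * a20 * c10; 0; 2 / d2%:R * a20; 0; 0] r.
Proof.
move=> [[h1 h2 h3] [h4 h5 h6]] /step1P/vec_eq0[[z1 z2 z3] [z4 z5 z6]].
apply/colP6; rewrite !mxE !inordK //= /before /= !big_nat1 !big_geq //.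
rewrite ?subnn ?subn0 -[(2 - 1)%N]/1%N h1 h2 h4 z2 z3 z4 z5 z6.
by rewrite !(mulr0, mul0r, oppr0, subr0, addr0, add0r) !mulrA.
Qed.

(** The last two rows only impose [e = 2 c_2]; the other rows then determine the remaining entries
    by division by 2 or 4. *)
Lemma res_solutions s (u : 'cV[C]_6) : initial d2 a10 a20 b0 s -> step d2 s 1 ->
  X d2 s 2 *m u = rhs d2 s 2 <-> exists z : C, u = res_point + z *: res_dir.
Proof.
move=> init_s step1; rewrite rhs2 // mulXP !mxE !inordK //=.
have [[h1 h2 h3] [h4 h5 h6]] := init_s.
rewrite h2 h3 h4 -[2%:~R]/2.
split=> [[[e0 e1 e2] [e3 e4 e5]]|[z ->]]; last first.
  by rewrite !mxE !inordK //=; split; split; field; rewrite ?d_neq0.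
exists (u (inord 4) 0); apply/colP6; rewrite !mxE !inordK //=.
have E5 : u (inord 5) 0 = 2 * u (inord 4) 0 by rewrite (subr0_eq e4).
have E0 : u (inord 0) 0 = - a10 * c10 by apply: (mulfI two_neq0); rewrite e0; ring.
split; split.
- by rewrite E0; ring.
- apply: (mulfI two_neq0).
  transitivity (- 4 * a20 * c10 - 2 * a20 * u (inord 4) 0); last by ring.
  by rewrite -e1; ring.
- apply: (mulfI two_neq0); rewrite (subr0_eq e2) E5; ring.
- have four : 4 != 0 :> C by rewrite pnatr_eq0.
  apply: (mulfI four).
  transitivity (2 / d2%:R * a20 + d2%:R^-1 * u (inord 0) 0 - c10 * u (inord 5) 0).
    by rewrite -e3; ring.
  by rewrite E0 E5; field; rewrite d_neq0.
- by ring.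
- by rewrite E5; ring.
Qed.

Lemma top_resonance2 s : initial d2 a10 a20 b0 s -> step d2 s 1 -> top_resonance d2 s 2.
Proof.
move=> init_s step1; split; last exact: resonance_le2.
apply/eqP/det_mx_colP; exists res_dir; first exact: res_dir_neq0.
(* The direction is in the kernel as the difference of the solutions for [z = 1] and [z = 0]. *)
have /(res_solutions _ init_s step1) : exists z : C, res_point + res_dir = res_point + z *: res_dir.
  by exists 1; rewrite scale1r.
rewrite mulmxDr; have /(res_solutions _ init_s step1) -> :
    exists z : C, res_point = res_point + z *: res_dir.
  by exists 0; rewrite scale0r addr0.
by rewrite -[RHS in _ = RHS -> _]addr0 => /addrI.
Qed.

Lemma compatible2 s : initial d2 a10 a20 b0 s -> step d2 s 1 -> compatible d2 s 2.
Proof.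
move=> init_s step1; exists res_point; apply/res_solutions => //.
by exists 0; rewrite scale0r addr0.
Qed.

(** Shows that the claims about all [s] passing step 1 are not vacuous. *)
Lemma ex_initial_step1 : exists s : coeffs C, initial d2 a10 a20 b0 s /\ step d2 s 1.
Proof.
pose f (c : C) (k : nat) : C := if k is 0 then c else 0.
exists (Coeffs (f a10) (f a20) (f b0) (f c10) (f (-1)) (f 1)).
by split=> //; apply/step1P/vec_eq0.
Qed.

Lemma ex_formal_solution s z : initial d2 a10 a20 b0 s -> step d2 s 1 ->
  exists s' : coeffs C, [/\ initial d2 a10 a20 b0 s',
    vec s' 2 = res_point + z *: res_dir & formal_solution d2 s'].
Proof.
(* Only indices up to 2 matter here: [extend_steps] recomputes everything beyond. *)
move=> init_s step1; pose f k := if k == 2%N then res_point + z *: res_dir else vec s k.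
have [s' [s'E s'step]] := extend_steps d2 (coeffs_of f).
have s'2 : vec s' 2 = res_point + z *: res_dir by rewrite s'E // vec_coeffs_of.
have s'01 k : (k < 2)%N -> vec s' k = vec s k.
  by move=> k2; rewrite s'E ?vec_coeffs_of /f ?(ltn_eqF k2) // ltnW.
have init_s' : initial d2 a10 a20 b0 s'.
  have /vecP[[h1 h2 h3] [h4 h5 h6]] := s'01 0 isT.
  by rewrite /initial h1 h2 h3 h4 h5 h6; exact: init_s.
exists s'; split=> //; apply/(formal_solution_step _ _ init_s') => // -[|[|[|i]]] // _.
- by apply/step1P; rewrite s'01 //; apply/(step1P d2).
- rewrite /step s'2 (@X_local _ d2 s' s) ?s'01 // (@rhs_local _ d2 s' s) //.
  by apply/res_solutions => //; exists z.
- exact: s'step.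
Qed.

(** The first integral leaves only index 2 to check. There [c_{2,2} = z] and [e_2 = 2z] give
    [- 2z - 4z + a_{1,0} + 1], which dictates the value of [z]. *)
Lemma formal_solution_on_H0 s : initial d2 a10 a20 b0 s ->
  vec s 2 = res_point + ((a10 + 1) / 6) *: res_dir ->
  formal_solution d2 s -> on_H0 d2 s.
Proof.
move=> init_s s2 sol_s; apply/on_H0P => i.
have [->|i_neq2] := eqVneq i 2%N; last first.
  by apply: energy_coef_eq0 => //; apply/formal_solutionP.
have /step1P/vec_eq0[_ [_ c21 e1]] : step d2 s 1.
  by move/(formal_solution_step d_neq0 two_neq0 init_s): sol_s; apply.
rewrite (energy_coef2 init_s) //.
have /colP6[_ []] := s2; rewrite !mxE !inordK //= => _ -> ->.
by field.
Qed.

End TopResonance.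

Theorem proposition5p2 (R : realType) (d2 : nat) (a10 a20 b0 : R[i])
    (d2_ge2 : (2 <= d2)%N) (d2_even : ~~ odd d2)
    (a10_neq0 : a10 != 0) (a20_neq0 : a20 != 0) (b0_neq0 : b0 != 0) :
  (exists s : coeffs R[i], initial d2 a10 a20 b0 s /\ step d2 s 1) /\
  (forall s : coeffs R[i], initial d2 a10 a20 b0 s -> step d2 s 1 ->
    [/\ top_resonance d2 s 2,
        compatible d2 s 2 &
        exists p w : 'cV[R[i]]_6,
          [/\ w != 0,
              (forall u : 'cV[R[i]]_6,
                 X d2 s 2 *m u = rhs d2 s 2 <->
                 exists z : R[i], u = p + z *: w) &
              exists z : R[i],
                (exists s' : coeffs R[i],
                   [/\ initial d2 a10 a20 b0 s', vec s' 2 = p + z *: w &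
                       formal_solution d2 s']) /\
                (forall s' : coeffs R[i],
                   initial d2 a10 a20 b0 s' -> vec s' 2 = p + z *: w ->
                   formal_solution d2 s' -> on_H0 d2 s')]]).
Proof.
have d2_gt0 : (0 < d2)%N by apply: ltnW.
split; first exact: ex_initial_step1.
move=> s init_s step1; split.
- exact: (top_resonance2 d2_gt0 init_s step1).
- exact: (compatible2 d2_gt0 init_s step1).
exists (res_point d2 a10 a20), (res_dir d2 a10 a20 b0); split.
- exact: res_dir_neq0.
- by move=> u; apply: res_solutions.
exists ((a10 + 1) / 6); split; first exact: (ex_formal_solution d2_gt0 _ init_s step1).
by move=> s' init_s' s'2; apply: (formal_solution_on_H0 d2_gt0 init_s' s'2).
Qed.
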